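(* Let $n\geq 5$ be an integer. The minimum coprime number of the cube $P_n^3$ of the path is given by $$\mathfrak{pr}(P_n^3)=\begin{cases} 6k-1 & \text{if } n=4k\text{ or } n=4k+1, \\ 6k+1 & \text{if } n=4k+2,\\ 6k+3 & \text{if } n=4k+3, \end{cases}$$ where $k$ is an integer.
   Context: $P_n$ is the path on $n$ vertices. The $k$-th power $G^k$ of a graph $G$ has the same vertex set as $G$, with an edge between distinct $u,v$ whenever the distance $d(u,v)$ in $G$ is at most $k$. All graphs are finite and simple. A coprime labeling of a graph $G$ of order $N$ is an assignment of distinct labels from $\{1,\ldots,M\}$, for some integer $M\ge N$, to the vertices of $G$ such that adjacent vertices receive relatively prime labels. The minimum coprime number $\mathfrak{pr}(G)$ is the minimum value $M$ for which such a labeling exists. *)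

(* Defs.v *)
From mathcomp Require Import all_boot.

Set Implicit Arguments.
Unset Strict Implicit.
Unset Printing Implicit Defensive.

Record sgraph := SGraph {
  vertex :> finType;
  edge : rel vertex;
  edge_sym : symmetric edge;
  edge_irrefl : irreflexive edge
}.

Definition has_walk (G : sgraph) (u v : G) (d : nat) : bool :=
  [exists p : d.-tuple G, path (@edge G) u p && (last u p == v)].

(* A shortest walk between connected vertices has length less than #|G|.
   The value is meaningful only if u and v are connected (otherwise it is the
   junk value #|G|), so uses of [dist] are guarded by [connect]. *)
Definition dist (G : sgraph) (u v : G) : nat :=
  find (has_walk u v) (iota 0 #|G|).

Lemma has_walk_sym (G : sgraph) (u v : G) d : has_walk u v d = has_walk v u d.
Proof.
have imp (a b : G) : has_walk a b d -> has_walk b a d.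
  case/existsP => p /andP[pp /eqP lp]; apply/existsP.
  have sz : size (rev (belast a p)) == d by rewrite size_rev size_belast size_tuple.
  exists (Tuple sz) => /=; apply/andP; split.
    rewrite -lp rev_path -(@eq_path _ (@edge G)) // => x y.
    exact: edge_sym.
  rewrite -lp; case: (tval p) => [|x q] //=.
  by rewrite rev_cons last_rcons.
by apply/idP/idP; apply: imp.
Qed.

Lemma dist_sym (G : sgraph) (u v : G) : dist u v = dist v u.
Proof. by apply: eq_find => d; apply: has_walk_sym. Qed.

Definition power_rel (G : sgraph) (k : nat) : rel G :=
  fun u v => [&& u != v, connect (@edge G) u v & dist u v <= k].

Lemma power_rel_sym (G : sgraph) k : symmetric (@power_rel G k).
Proof.
move=> u v; rewrite /power_rel eq_sym dist_sym.
by rewrite (sym_connect_sym (@edge_sym G)).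
Qed.

Lemma power_rel_irrefl (G : sgraph) k : irreflexive (@power_rel G k).
Proof. by move=> u; rewrite /power_rel eqxx. Qed.

Definition gpower (G : sgraph) (k : nat) : sgraph :=
  SGraph (@power_rel_sym G k) (@power_rel_irrefl G k).

Definition path_rel (n : nat) : rel 'I_n :=
  fun i j => (i.+1 == j :> nat) || (j.+1 == i :> nat).

Lemma path_rel_sym n : symmetric (@path_rel n).
Proof. by move=> i j; rewrite /path_rel orbC. Qed.

Lemma path_rel_irrefl n : irreflexive (@path_rel n).
Proof. by move=> i; rewrite /path_rel orbb eqn_leq ltnn. Qed.

Definition path_graph (n : nat) : sgraph :=
  SGraph (@path_rel_sym n) (@path_rel_irrefl n).

Definition coprime_labeling (G : sgraph) (M : nat)
    (f : {ffun G -> 'I_M.+1}) : bool :=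
  [&& injectiveb f,
      [forall v, 0 < f v]
    & [forall u, forall v, edge u v ==> coprime (f u) (f v)]].

Definition coprime_labelable (G : sgraph) (M : nat) : bool :=
  (#|G| <= M) && [exists f : {ffun G -> 'I_M.+1}, coprime_labeling f].

Lemma prime_seq_exists :
  exists p : nat -> nat, (forall i, prime (p i)) /\ (forall i, p i < p i.+1).
Proof.
pose next m := s2val (prime_above m).
have nextP m : m < next m /\ prime (next m).
  by rewrite /next; case: (prime_above m).
exists (fun i => iter i next 2); split=> [[|i] //|i]; rewrite iterS.
- by case: (nextP (iter i next 2)).
- by case: (nextP (iter i next 2)).
Qed.

Lemma coprime_labelable_exists (G : sgraph) : exists M, coprime_labelable G M.
Proof.
have [p [p_prime p_lt]] := prime_seq_exists.
have p_mono : {mono p : i j / i <= j}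
  by exact: leq_mono (homo_ltn ltn_trans p_lt).
have p_inj : injective p.
  by move=> i j e; apply/eqP; rewrite eqn_leq -[i <= j]p_mono -[j <= i]p_mono e leqnn.
have p_ge i : i <= p i.
  by elim: i => // i IH; apply: leq_ltn_trans IH (p_lt i).
have p_bound (v : G) : p (enum_rank v) < (p #|G|).+1.
  by rewrite ltnS p_mono ltnW.
exists (p #|G|); rewrite /coprime_labelable p_ge /=; apply/existsP.
exists [ffun v => Ordinal (p_bound v)]; apply/and3P; split.
- apply/injectiveP => u v; rewrite !ffunE => /(congr1 val) /= /p_inj.
  by move/val_inj/enum_rank_inj.
- by apply/forallP => v; rewrite ffunE /= prime_gt0.
- apply/forallP => u; apply/forallP => v; apply/implyP => uv.
  rewrite !ffunE /= prime_coprime // dvdn_prime2 //.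
  apply: contraTN uv => /eqP/p_inj/val_inj/enum_rank_inj ->.
  by rewrite edge_irrefl.
Qed.

Definition min_coprime_number (G : sgraph) : nat :=
  ex_minn (coprime_labelable_exists G).

(* Main.v *)
Require Import Defs.
From mathcomp Require Import all_boot.
From mathcomp Require Import zify.

(** Why the formula holds. All three cases say that the minimum coprime number
    of the cube of the path is 2 m - 1, where m = n - ceil(n / 4).

    Any four consecutive vertices of the path are pairwise adjacent in its
    cube, so at most one of them carries an even label and at most ceil(n / 4)
    labels are even. The m or more remaining labels are distinct odd numbers,
    and the largest of them is at least 2 m - 1 ([path_cube_label_bound]).

    For a labeling that reaches this bound, put even labels at the positions
    0, 4, 8, ... and fill the other positions with 1, 3, 5, ... in order. Two odd
    labels within distance 3 differ by 2 or 4, so they are coprime. The even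
    label at position 4 i, for i > 0, has to be coprime to the six odd numbers from
    6 i - 5 to 6 i + 5. It is taken among 6 i - 4, 6 i - 2 and 6 i + 2: none
    is divisible by 3, and all differences are below 11, so it is enough
    that the label avoids the primes 5 and 7. At least one of the three does:
    they differ by 2, 4 or 6, so each of 5 and 7 divides at most one of them.
    With the order of preference in [even_label] the even labels are strictly
    increasing, hence distinct. Near the right end 6 i + 2 can exceed the
    bound, but there fewer odd neighbours remain and 6 i - 2 is always
    good. *)

(** * Adjacency in powers of paths *)

Lemma path_walk_bound {n} (u : 'I_n) (p : seq 'I_n) :
  path (@path_rel n) u p ->
  last u p <= u + size p /\ u <= last u p + size p.
Proof.
elim: p u => [|w p IH] u /=; first by rewrite addn0.
case/andP => uw /IH [h1 h2]; move: uw; rewrite /path_rel.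
by move=> uw; lia.
Qed.

(** Walking straight to the right realises the distance between two vertices;
    [path_walk_bound] shows that no walk is shorter. *)
Lemma path_walk_up {n} d (u v : 'I_n) :
  u + d = v -> exists p : seq 'I_n,
    [/\ size p = d, path (@path_rel n) u p & last u p = v].
Proof.
elim: d u => [|d IH] u uv.
  by exists [::]; split=> //=; apply: val_inj; rewrite /= -uv addn0.
have lt_n : u.+1 < n by have := ltn_ord v; lia.
have [p [sz_p walk_p last_p]] := IH (Ordinal lt_n) ltac:(move=> /=; lia).
exists (Ordinal lt_n :: p); split; rewrite /= ?sz_p //.
by apply/andP; split; rewrite // /path_rel eqxx.
Qed.

Lemma has_walk_path_graph {n} (u v : 'I_n) :
  @has_walk (path_graph n) u v ((u - v) + (v - u)).
Proof.
wlog le_uv : u v / u <= v.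
  by move=> W; case: (leqP u v) => [|/ltnW] /W //; rewrite has_walk_sym addnC.
have [p [sz_p walk_p last_p]] := @path_walk_up n (v - u) u v ltac:(lia).
have -> : (u - v) + (v - u) = size p by lia.
by apply/existsP; exists (in_tuple p); rewrite /= walk_p last_p eqxx.
Qed.

Lemma connect_path_graph {n} (u v : 'I_n) :
  connect (@edge (path_graph n)) u v.
Proof.
have /existsP[p /andP[walk_p /eqP last_p]] := has_walk_path_graph u v.
by apply/connectP; exists p.
Qed.

Lemma dist_path_graph {n} (u v : 'I_n) :
  @dist (path_graph n) u v = (u - v) + (v - u).
Proof.
set d := _ + _.
have lt_dn : d < n by have := ltn_ord u; have := ltn_ord v; rewrite /d; lia.
have has_d : has (@has_walk (path_graph n) u v) (iota 0 #|path_graph n|).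
  by apply/hasP; exists d; rewrite ?has_walk_path_graph // mem_iota card_ord.
apply/eqP; rewrite eqn_leq; apply/andP; split.
  rewrite leqNgt; apply/negP => /(before_find 0).
  by rewrite nth_iota ?card_ord // add0n has_walk_path_graph.
have := nth_find 0 has_d; rewrite has_find size_iota in has_d.
rewrite nth_iota // add0n -/(@dist (path_graph n) u v).
move=> /existsP[p /andP[/path_walk_bound bound_p /eqP last_p]].
by move: bound_p; rewrite last_p size_tuple /d; lia.
Qed.

Lemma edge_power_path n k (u v : 'I_n) :
  @edge (gpower (path_graph n) k) u v = [&& u != v, u <= v + k & v <= u + k].
Proof.
rewrite /= /power_rel connect_path_graph dist_path_graph /=.
by case: (u != v) => //=; lia.
Qed.

(** * The lower bound *)

Lemma min_coprime_number_eq G m :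
    coprime_labelable G m ->
    (forall M, coprime_labelable G M -> m <= M) ->
  min_coprime_number G = m.
Proof.
move=> lab_m min_m; rewrite /min_coprime_number.
case: ex_minnP => M lab_M min_M.
by apply/eqP; rewrite eqn_leq min_M ?min_m.
Qed.

Lemma leq_card_nat (T : finType) (A : {set T}) (g : T -> nat) m :
  {in A &, injective g} -> {in A, forall x, g x < m} -> #|A| <= m.
Proof.
move=> inj_g lt_g; rewrite cardE -(size_map g) -[m in _ <= m](size_iota 0).
apply: uniq_leq_size => [|_ /mapP[x xA ->]].
  by rewrite map_inj_in_uniq ?enum_uniq // => x y; rewrite !mem_enum; apply: inj_g.
by rewrite mem_iota lt_g // -mem_enum.
Qed.

(** Each block of four consecutive vertices is a clique, so it holds at most one
    even label; the odd labels up to [M] number [M.+1 %/ 2]. *)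
Lemma path_cube_label_bound n M :
  coprime_labelable (gpower (path_graph n) 3) M ->
  n - (n + 3) %/ 4 <= M.+1 %/ 2.
Proof.
case/andP=> _ /existsP[f /and3P[/injectiveP inj_f _ /forallP cop_f]].
pose E := [set v | ~~ odd (f v)].
have cardE : #|E| <= (n + 3) %/ 4.
  apply: (@leq_card_nat _ _ (fun v : 'I_n => v %/ 4)) => [u v|v _]; last first.
    by have := ltn_ord v; lia.
  rewrite !inE => ev_u ev_v eq_uv; apply/eqP/negPn/negP => ne_uv.
  have uv : @edge (gpower (path_graph n) 3) u v.
    by rewrite edge_power_path ne_uv /=; move: eq_uv => /=; lia.
  have /forallP/(_ v)/implyP/(_ uv) := cop_f u.
  rewrite /coprime => /eqP cop_uv.
  have : 2 %| gcdn (f u) (f v) by rewrite dvdn_gcd !dvdn2 ev_u.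
  by rewrite cop_uv.
have cardO : #|~: E| <= M.+1 %/ 2.
  apply: (@leq_card_nat _ _ (fun v => f v %/ 2)) => [u v|v]; rewrite !inE !negbK.
    move=> od_u od_v eq_uv; apply/inj_f/val_inj.
    by case: (f u) (f v) od_u od_v eq_uv => [a _] [b _] /=; lia.
  by case: (f v) => [a lt_a] /=; lia.
have := cardsC E; have -> : #|gpower (path_graph n) 3| = n by rewrite card_ord.
by lia.
Qed.

(** * An optimal labeling *)

(** Reduces the existence of a labeling to conditions on a numerical function of
    the position, where only pairs [p < q] matter by symmetry. *)
Lemma power_path_labelable n k M (f : nat -> nat) :
    n <= M ->
    (forall p, p < n -> 0 < f p <= M) ->
    (forall p q, p < q < n -> f p != f q) ->
    (forall p q, p < q < n -> q <= p + k -> coprime (f p) (f q)) ->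
  coprime_labelable (gpower (path_graph n) k) M.
Proof.
move=> le_nM range_f inj_f cop_f; rewrite /coprime_labelable card_ord le_nM /=.
have val_f (v : 'I_n) : inord (n' := M) (f v) = f v :> nat.
  by rewrite inordK // ltnS; case/andP: (range_f v (ltn_ord v)).
apply/existsP; exists [ffun v : 'I_n => inord (f v)]; apply/and3P; split.
- apply/injectiveP => u v; rewrite !ffunE => /(congr1 val) /=; rewrite !val_f.
  move=> eq_f; apply: val_inj; case: (ltngtP u v) => // lt.
    by have := inj_f u v; rewrite lt ltn_ord eq_f eqxx => /(_ isT).
  by have := inj_f v u; rewrite lt ltn_ord eq_f eqxx => /(_ isT).
- apply/forallP => v; rewrite ffunE val_f.
  by case/andP: (range_f v (ltn_ord v)).
- apply/forallP => u; apply/forallP => v; apply/implyP.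
  rewrite edge_power_path !ffunE !val_f => /and3P[ne_uv le_uv le_vu].
  case: (ltngtP u v) => [lt|lt|/val_inj eq_uv]; last by rewrite eq_uv eqxx in ne_uv.
    by apply: cop_f; rewrite ?lt ?ltn_ord.
  by rewrite coprime_sym; apply: cop_f; rewrite ?lt ?ltn_ord.
Qed.

(** A common prime factor divides the difference, which is at most 10; the next
    prime after 7 is 11. *)
Lemma coprime_near a b :
    a != b -> a <= b + 10 -> b <= a + 10 ->
    {in [:: 2; 3; 5; 7], forall q, q %| a -> ~~ (q %| b)} ->
  coprime a b.
Proof.
wlog lt_ab : a b / a < b.
  move=> W ne_ab le_ab le_ba small; case: (ltngtP a b) => [lt|lt|eq_ab].
  - exact: W.
  - rewrite coprime_sym; apply: W => // [|q qs]; first by rewrite eq_sym.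
    by move=> q_b; apply: contraL q_b => /(small q qs).
  - by rewrite eq_ab eqxx in ne_ab.
move=> _ _ le_ba small; apply/negPn/negP => ncop.
have gt1 : 1 < gcdn a b by rewrite ltn_neqAle eq_sym ncop gcdn_gt0; lia.
have q_pr := pdiv_prime gt1; have := pdiv_dvd (gcdn a b).
move: (pdiv _) q_pr => q q_pr; rewrite dvdn_gcd => /andP[q_a q_b].
have q_le : q <= 10.
  have : q %| b - a by rewrite dvdn_subr // ltnW.
  by move/dvdn_leq; lia.
have qs : q \in [:: 2; 3; 5; 7].
  by move: q q_pr q_le {q_a q_b}; do 11?[case=> //].
by have := small q qs q_a; rewrite q_b.
Qed.

(** The label of position [4 * i]. The first test detects the last even position
    when at most one vertex follows it: there 6 i - 2 is within 3 of every
    adjacent odd label, whereas 6 i + 2 may exceed the bound. For [i = 0] both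
    truncated differences are 0, which is not coprime to 35, so the label is
    2. *)
Definition even_label n i :=
  if n <= 4 * i + 2 then 6 * i - 2
  else if coprime 35 (6 * i - 2) then 6 * i - 2
  else if coprime 35 (6 * i - 4) then 6 * i - 4
  else 6 * i + 2.

(** Off the multiples of 4 this enumerates the odd numbers in order. *)
Definition label n p :=
  if p %% 4 == 0 then even_label n (p %/ 4)
  else 6 * (p %/ 4) + 2 * (p %% 4) - 1.

Lemma coprime35 m : coprime 35 m = ~~ (5 %| m) && ~~ (7 %| m).
Proof. by rewrite -[35]/(5 * 7) coprimeMl !prime_coprime. Qed.

Lemma even_label_bounds n i : 4 < n -> 4 * i < n ->
  [/\ ~~ odd (even_label n i), ~~ (3 %| even_label n i),
      6 * i - 4 <= even_label n i <= 6 * i + 2 &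
      0 < even_label n i <= (n - (n + 3) %/ 4).*2.-1].
Proof.
move=> n_gt4 lt_in; rewrite /even_label !coprime35.
case: ifP => [|n_gt]; first by move=> n_le; split; lia.
case: ifP => [/andP[c5 c7]|_]; first by split; lia.
case: ifP => [/andP[c5 c7]|_]; first by split; lia.
by split; lia.
Qed.

(** For [0 < i] the three candidates differ by 2, 4 or 6, so 5 and 7 exclude at
    most one of them each; for [i = 0] the label is 2. *)
Lemma even_label_interior n i :
  4 * i + 2 < n -> coprime 35 (even_label n i).
Proof.
move=> n_gt; rewrite /even_label leqNgt n_gt /=.
case: ifP => // /negbT c1; case: ifP => // /negbT.
by move: c1; rewrite !coprime35; lia.
Qed.

(** The candidates for [i] and [i.+1] share only the value 6 i + 2. It is chosen
    for [i] when 5 and 7 each divide one of 6 i - 4 and 6 i - 2, and then neither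
    divides the first choice 6 i + 4 for [i.+1]. *)
Lemma even_label_lt n i j : i < j -> 4 * j < n -> even_label n i < even_label n j.
Proof.
move=> lt_ij lt_jn; have := @even_label_bounds n i ltac:(lia) ltac:(lia).
have := @even_label_bounds n j ltac:(lia) lt_jn.
case=> _ _ /andP[lo_j _] _ [_ _ /andP[_ hi_i] _].
have [eq_j|] := eqVneq j i.+1; last by lia.
rewrite {lo_j hi_i} eq_j /even_label !coprime35.
have -> : (n <= 4 * i + 2) = false by lia.
case: ifP => [_|/negbT c1]; first by do ?case: ifP => _; lia.
case: ifP => [_|/negbT c2]; first by do ?case: ifP => _; lia.
by do ?case: ifP => [_|/negbT ?]; lia.
Qed.

(** All differences are at most 9, so the primes 2, 3, 5 and 7 have to be
    excluded. Parity and [even_label_bounds] exclude 2 and 3. When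
    two or more vertices follow, the even label is coprime to 35; otherwise it
    is within 3 of each odd neighbour. *)
Lemma even_odd_label_coprime n i q :
    4 < n -> 4 * i < n -> q < n -> q %% 4 != 0 -> q <= 4 * i + 3 -> 4 * i <= q + 3 ->
  coprime (even_label n i) (label n q).
Proof.
move=> n_gt4 lt_in lt_qn q_odd le_q le_i; rewrite /label (negbTE q_odd).
have [ev n3 range_e pos_e] := even_label_bounds n i n_gt4 lt_in.
apply: coprime_near; [lia|lia|lia|] => d.
rewrite !inE => /or4P[] /eqP-> {d}; [lia|lia| |];
  have [n_le|/even_label_interior] := leqP n (4 * i + 2);
  rewrite ?coprime35; try (move=> /andP[c5 c7]; lia);
  rewrite /even_label n_le; lia.
Qed.

(** Odd labels at distance at most 3 differ by 2 or 4, because the even position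
    that may lie between them does not advance the odd sequence. *)
Lemma label_coprime n p q :
  4 < n -> p < q < n -> q <= p + 3 -> coprime (label n p) (label n q).
Proof.
move=> n_gt4 /andP[lt_pq lt_qn] le_qp.
have [p0|p_odd] := eqVneq (p %% 4) 0.
  by rewrite {1}/label p0 eqxx; apply: even_odd_label_coprime; lia.
have [q0|q_odd] := eqVneq (q %% 4) 0.
  by rewrite coprime_sym {1}/label q0 eqxx; apply: even_odd_label_coprime; lia.
rewrite /label (negbTE p_odd) (negbTE q_odd).
apply: coprime_near; [lia|lia|lia|] => d.
by rewrite !inE => /or4P[] /eqP-> {d}; lia.
Qed.

Lemma label_neq n p q : 4 < n -> p < q < n -> label n p != label n q.
Proof.
move=> n_gt4 /andP[lt_pq lt_qn]; rewrite /label.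
have [|p4 _ _ _] := @even_label_bounds n (p %/ 4) n_gt4; first by lia.
have [|q4 _ _ _] := @even_label_bounds n (q %/ 4) n_gt4; first by lia.
have [p0|p_odd] := eqVneq (p %% 4) 0; have [q0|q_odd] := eqVneq (q %% 4) 0; try lia.
by have := @even_label_lt n (p %/ 4) (q %/ 4); lia.
Qed.

Lemma label_range n p :
  4 < n -> p < n -> 0 < label n p <= (n - (n + 3) %/ 4).*2.-1.
Proof.
move=> n_gt4 lt_pn; rewrite /label; case: eqP => [p0|p_odd]; last by lia.
by have [|_ _ _ ->] := @even_label_bounds n (p %/ 4) n_gt4; first by lia.
Qed.

Lemma min_coprime_number_path_cube n : 4 < n ->
  min_coprime_number (gpower (path_graph n) 3) = (n - (n + 3) %/ 4).*2.-1.
Proof.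
move=> n_gt4; apply: min_coprime_number_eq => [|M /path_cube_label_bound]; last by lia.
apply: (@power_path_labelable _ _ _ (label n)) => [|p|p q|p q]; first by lia.
- exact: label_range.
- exact: label_neq.
- exact: label_coprime.
Qed.

Theorem theorem16 (n k : nat) (n_ge5 : 5 <= n) :
  [/\ n = 4 * k \/ n = 4 * k + 1 ->
        min_coprime_number (gpower (path_graph n) 3) = 6 * k - 1,
      n = 4 * k + 2 ->
        min_coprime_number (gpower (path_graph n) 3) = 6 * k + 1
    & n = 4 * k + 3 ->
        min_coprime_number (gpower (path_graph n) 3) = 6 * k + 3].
Proof. by rewrite min_coprime_number_path_cube //; split; lia. Qed.
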